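(* Let $S$ be an infinite set of positive integers and let $p_S(n)$ be the number of partitions of $n$ whose parts all belong to $S$. Then $p_S(n)$ is of superpolynomial growth: for every fixed $k$, the assertion $p_S(n)=O(n^k)$ is false. Moreover this is best possible in the following sense: if $\epsilon(n)$ is any function of $n$ with $\epsilon(n)\to\infty$, then there exists an infinite set $S$ of positive integers such that $p_S(n)=O(n^{\epsilon(n)})$.
   Context: $p_S(n)$ counts partitions of $n$ into parts from $S$, with arbitrary multiplicities. *)

(* Defs.v *)
From HB Require Import structures.
From mathcomp Require Export all_boot all_order all_algebra finmap.
From mathcomp Require Export all_classical all_reals all_analysis.

Set Implicit Arguments.
Unset Strict Implicit.
Unset Printing Implicit Defensive.

Export Order.TTheory GRing.Theory Num.Theory.
Export numFieldNormedType.Exports.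

Global Open Scope classical_set_scope.
Global Open Scope ring_scope.

(* A partition is encoded as the nonincreasing list of its parts. *)
Definition is_partition (n : nat) (s : seq nat) : Prop :=
  [/\ sorted geq s, all (leq 1) s & sumn s = n].

Definition partitions_in (S : set nat) (n : nat) : set (seq nat) :=
  [set s | is_partition n s /\ (forall x, x \in s -> S x)].

Lemma finite_partitions_in (S : set nat) (n : nat) :
  finite_set (partitions_in S n).
Proof.
have szle (s : seq nat) : all (leq 1) s -> (size s <= sumn s)%N.
  by elim: s => //= x s IH /andP[x0 /IH sz]; rewrite -add1n leq_add.
have mem_le (s : seq nat) x : x \in s -> (x <= sumn s)%N.
  elim: s => //= y s IH; rewrite inE => /orP[/eqP->|/IH xs].
    exact: leq_addr.
  exact: leq_trans xs (leq_addl _ _).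
pose f (t : n.-bseq 'I_n.+1) : seq nat := map val (bseqval t).
have /sub_finite_set : partitions_in S n `<=` f @` [set: n.-bseq 'I_n.+1].
  move=> s [[_ s_gt0 sn] _].
  have sz : (size (map (@inord n) s) <= n)%N by rewrite size_map -sn szle.
  exists (Bseq sz) => //; rewrite /f /= -map_comp map_id_in // => x xs /=.
  by rewrite inordK // ltnS -sn mem_le.
by apply; apply: finite_image; exact: finite_finset.
Qed.

(* [fset_set] is only meaningful on finite sets: see [finite_partitions_in]. *)
Definition pS (S : set nat) (n : nat) : nat := #|` fset_set (partitions_in S n)|.

(* Main.v *)
Require Import Defs.

Set Implicit Arguments.
Unset Strict Implicit.
Unset Printing Implicit Defensive.

(** Lower bound: given distinct [a_0, ..., a_m] in [S], put
    [n = a_0 (a_1 + ... + a_m) t].  Using [a_i] exactly [a_0 u_i] times, with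
    [0 <= u_i <= t] arbitrary, leaves a nonnegative multiple of [a_0], which
    copies of [a_0] fill up; so [p_S(n) >= (t + 1)^m], of order [n^m].

    Upper bound: a partition of [n] is determined by its multiplicities, so
    [p_S(n) <= (n + 1)^j <= n^(2j)] where [j] is the number of elements of [S]
    up to [n].  If the [j]-th element of [S] is so large that
    [2j <= eps(n)] from there on, this is at most [n^eps(n)]. *)

(** Left unsorted, which makes sums and multiplicities easy to compute; [partitions_in_sort] later
    turns such a list into a partition. *)
Definition parts_of (I : finType) (a c : I -> nat) : seq nat :=
  flatten [seq nseq (c i) (a i) | i <- index_enum I].

Lemma sumn_parts_of (I : finType) (a c : I -> nat) :
  sumn (parts_of a c) = (\sum_i a i * c i)%N.
Proof.
rewrite sumn_flatten sumnE !big_map.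
by apply: eq_bigr => i _; rewrite sumn_nseq.
Qed.

Lemma mem_parts_of (I : finType) (a c : I -> nat) x :
  x \in parts_of a c -> exists i, x = a i.
Proof.
by move=> /flatten_mapP[i _]; rewrite mem_nseq => /andP[_ /eqP ->]; exists i.
Qed.

Lemma count_parts_of (I : finType) (a c : I -> nat) i :
  injective a -> count_mem (a i) (parts_of a c) = c i.
Proof.
move=> a_inj; rewrite count_flatten sumnE !big_map /=.
rewrite (bigD1 i) //= big1 => [|j ji]; rewrite count_nseq /= ?eqxx ?mul1n ?addn0 //.
by rewrite (inj_eq a_inj) (negbTE ji).
Qed.

Lemma partitions_in_sort (S : set nat) (s : seq nat) :
  S `<=` [set n | (0 < n)%N] -> (forall x, x \in s -> S x) ->
  partitions_in S (sumn s) (sort geq s).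
Proof.
move=> S_gt0 sS; split; last by move=> x; rewrite mem_sort; exact: sS.
split.
- by apply: sort_sorted => x y; exact: leq_total.
- by apply/allP => x; rewrite mem_sort => /sS /S_gt0.
- by apply: perm_sumn; rewrite perm_sort.
Qed.

Lemma pS_ge_card (S : set nat) (n : nat) (T : finType) (f : T -> seq nat) :
  injective f -> (forall t, partitions_in S n (f t)) -> (#|T| <= pS S n)%N.
Proof.
move=> f_inj fP; rewrite cardE -(size_map f).
apply: uniq_leq_size; first by rewrite map_inj_uniq ?enum_uniq.
move=> _ /mapP[t _ ->]; rewrite in_fset_set ?inE; first exact: fP.
exact: finite_partitions_in.
Qed.

Lemma pS_le_card (S : set nat) (n : nat) (T : finType) (f : seq nat -> T) :
  {in partitions_in S n &, injective f} -> (pS S n <= #|T|)%N.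
Proof.
move=> f_inj; have finP := @finite_partitions_in S n.
rewrite /pS -(size_map f) -(card_uniqP _) ?max_card //.
rewrite map_inj_in_uniq ?fset_uniq // => s t.
by rewrite !in_fset_set //; exact: f_inj.
Qed.

Lemma pS_lower_bound (S : set nat) (I : finType) (a0 : nat) (a : I -> nat) t :
  S `<=` [set n | (0 < n)%N] -> S a0 -> (forall i, S (a i)) ->
  injective a -> (forall i, a i != a0) ->
  (t.+1 ^ #|I| <= pS S (a0 * (\sum_i a i) * t))%N.
Proof.
move=> S_gt0 Sa0 Sa a_inj aNa0; rewrite -[t.+1]card_ord -card_ffun.
(* The number of filler copies of [a0]. The subtraction does not truncate, since each [u i] is at
   most [t]. *)
pose c0 (u : {ffun I -> 'I_t.+1}) := ((\sum_i a i) * t - \sum_i a i * u i)%N.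
pose s u := nseq (c0 u) a0 ++ parts_of a (fun i => a0 * u i)%N.
apply: (@pS_ge_card _ _ _ (fun u => sort geq (s u))) => [u v suv | u].
  apply/ffunP => i; apply/val_inj/eqP.
  (* After scaling by [a0 > 0], [u i] becomes the multiplicity of [a i], to which the filler
     contributes nothing because [a i != a0]. *)
  rewrite -(eqn_pmul2l (S_gt0 _ Sa0)); apply/eqP.
  have /permP/(_ (pred1 (a i))) : perm_eq (s u) (s v).
    by apply/permPl => p; rewrite -(perm_sort geq (s u)) suv perm_sort.
  rewrite !count_cat !count_nseq /= [a0 == _]eq_sym (negbTE (aNa0 i)) !add0n.
  by rewrite !count_parts_of.
suff <- : sumn (s u) = (a0 * (\sum_i a i) * t)%N.
  apply: partitions_in_sort => // x; rewrite mem_cat => /orP[|].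
    by rewrite mem_nseq => /andP[_ /eqP ->].
  by move=> /mem_parts_of[i ->].
rewrite sumn_cat sumn_nseq sumn_parts_of.
under eq_bigr do rewrite mulnCA.
rewrite -big_distrr /= -mulnDr -mulnA subnK //.
rewrite big_distrl /=; apply: leq_sum => i _.
by rewrite leq_mul2l -ltnS ltn_ord orbT.
Qed.

Lemma count_leq_sumn (s : seq nat) x : (0 < x)%N -> (count_mem x s <= sumn s)%N.
Proof.
move=> x_gt0; elim: s => //= y s IH; apply: leq_add => //.
by case: eqP => // ->.
Qed.

Lemma mem_leq_sumn (s : seq nat) x : x \in s -> (x <= sumn s)%N.
Proof.
elim: s => //= y s IH; rewrite inE => /orP[/eqP->|/IH xs]; first exact: leq_addr.
exact: leq_trans xs (leq_addl _ _).
Qed.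

Lemma pS_upper_bound (S : set nat) (I : finType) (a : I -> nat) n :
  S `<=` [set n | (0 < n)%N] ->
  (forall x, S x -> (x <= n)%N -> exists i, x = a i) ->
  (pS S n <= n.+1 ^ #|I|)%N.
Proof.
move=> S_gt0 Sa; rewrite -[n.+1]card_ord -card_ffun.
(* [inord] loses nothing at a positive [a i]: a positive part occurs at most [n] times in a
   partition of [n]. *)
pose f (s : seq nat) := [ffun i : I => inord (count_mem (a i) s) : 'I_n.+1].
apply: (@pS_le_card _ _ _ f) => s1 s2.
rewrite !inE => -[[s1_sorted s1_gt0 s1n] s1S] [[s2_sorted s2_gt0 s2n] s2S] f12.
have geq_anti : antisymmetric geq by move=> x y /anti_leq.
have geq_trans : transitive geq by move=> y x z xy yz; exact: leq_trans yz xy.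
apply: (sorted_eq geq_trans geq_anti) => //; rewrite /perm_eq.
apply/allP => x xs /=; have [Sx xn] : S x /\ (x <= n)%N.
  move: xs; rewrite mem_cat => /orP[xs|xs]; split.
  - exact: s1S.
  - by rewrite -s1n mem_leq_sumn.
  - exact: s2S.
  - by rewrite -s2n mem_leq_sumn.
have x_gt0 := S_gt0 _ Sx; have [i xai] := Sa _ Sx xn.
have := congr1 (fun g : {ffun I -> 'I_n.+1} => val (g i)) f12.
rewrite !ffunE -xai /= !inordK ?ltnS => [->//||].
  by rewrite -s2n count_leq_sumn.
by rewrite -s1n count_leq_sumn.
Qed.

Lemma pS_superpolynomial (R : realType) (S : set nat) (k : R) :
  S `<=` [set n | (0 < n)%N] -> infinite_set S ->
  ~ ((fun n : nat => (pS S n)%:R : R) =O_\oo (fun n : nat => n%:R `^ k)).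
Proof.
move=> S_gt0 S_inf /eqO_exP[C C_gt0 [N _ pS_le]].
(* A natural exponent above [k]. One filler and [m.+1] further elements of [S] give growth of order
   [m.+1], hence the [m.+2] elements below. *)
set m := Num.Def.archi_bound `|k|.
have km : k <= m%:R.
  by apply: le_trans (ler_norm k) _; apply/ltW/archi_boundP.
have [B BS B_ge] := infinite_set_fset m.+2 S_inf.
pose b := nth 0%N B.
have Sb i : (i < m.+2)%N -> S (b i).
  by move=> im; apply: BS; rewrite /= mem_nth // (leq_trans im).
have b_inj i j : (i < m.+2)%N -> (j < m.+2)%N -> b i = b j -> i = j.
  by move=> im jm /eqP; rewrite nth_uniq ?fset_uniq ?(leq_trans _ B_ge) // => /eqP.
pose a (i : 'I_m.+1) := b i.+1.
set D := (b 0%N * \sum_i a i)%N.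
have pS_ge t : (t.+1 ^ m.+1 <= pS S (D * t))%N.
  rewrite -[X in (_ ^ X)%N]card_ord; apply: pS_lower_bound => //.
  - exact: Sb.
  - by move=> i; apply: Sb; rewrite ltnS.
  - by move=> i j /b_inj ij; apply/val_inj/succn_inj/ij; rewrite ltnS.
  - by move=> i; apply/eqP => /b_inj; rewrite ltnS ltn_ord => /(_ isT isT).
have D_gt0 : (0 < D)%N.
  rewrite muln_gt0 (S_gt0 _ (Sb _ _)) //= big_ord_recl addn_gt0.
  by rewrite (S_gt0 _ (Sb _ _)).
set M := C * D%:R ^+ m.
have M_ge0 : 0 <= M by rewrite mulr_ge0 ?exprn_ge0 // ltW.
(* At [n = D * t] the assumed bound is at most [M * t.+1 ^ m], which [t.+1 ^ m.+1] exceeds once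
   [t.+1 > M]. Taking [t >= N] puts [n] in the range of that bound. *)
pose t := (maxn N (Num.Def.archi_bound M)).+1.
have t_gt0 : 0 < t.+1%:R :> R by [].
have /pS_le : (N <= D * t)%N.
  apply: (@leq_trans t); last exact: leq_pmull.
  by rewrite ltnW // ltnS leq_maxl.
rewrite /= ger0_norm // ger0_norm ?powR_ge0 // leNgt => /negP; apply.
apply: (@lt_le_trans _ _ (t.+1 ^ m.+1)%:R); last by rewrite ler_nat.
apply: (@le_lt_trans _ _ (C * (D * t)%:R ^+ m)).
  rewrite ler_pM2l // -powR_mulrn //; apply: ler_powR => //.
  by rewrite ler1n muln_gt0 D_gt0.
rewrite natrM exprMn mulrA -/M natrX exprS.
apply: (@le_lt_trans _ _ (M * t.+1%:R ^+ m)).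
  by rewrite ler_wpM2l // lerXn2r ?nnegrE // ler_nat.
rewrite ltr_pM2r ?exprn_gt0 //; apply: lt_le_trans (archi_boundP M_ge0) _.
by rewrite ler_nat; do 2 apply: leqW; exact: leq_maxr.
Qed.

Lemma slow_pS_exists (R : realType) (eps : nat -> R) : eps @ \oo --> +oo ->
  exists S : set nat,
    [/\ S `<=` [set n | (0 < n)%N],
        infinite_set S &
        (fun n : nat => (pS S n)%:R : R) =O_\oo (fun n : nat => n%:R `^ eps n)].
Proof.
move=> /cvgryPge eps_oo.
have /choice[N epsN] : forall j : nat, exists N : nat, forall n : nat,
    (N <= n)%N -> (j.*2)%:R <= eps n.
  by move=> j; have [N _ NP] := eps_oo (j.*2)%:R; exists N => n /NP.
(* Partial sums with positive terms make [s] strictly increasing. The index is shifted because from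
   [s j] on there are at least [j.+1] elements of [S] to pay for, so [eps] must have reached
   [2 * j.+1]. *)
pose s j := (\sum_(i < j.+1) (N i.+1).+1)%N.
have s_lt j : (s j < s j.+1)%N.
  by rewrite /s [X in (_ < X)%N]big_ord_recr /= addnS ltnS leq_addr.
have s_mono : {mono s : i j / (i <= j)%N} by apply: leq_mono; apply: homo_ltn => // j i k; exact: ltn_trans.
have s_gt j : (j < s j)%N.
  by elim: j => [|j IH]; [rewrite /s big_ord1|exact: leq_ltn_trans IH (s_lt j)].
have s_ge j : (N j.+1 <= s j)%N.
  by rewrite /s big_ord_recr /= (leq_trans (leqnSn _)) // leq_addl.
have S_gt0 : range s `<=` [set n | (0 < n)%N].
  by move=> _ [j _ <-]; exact: leq_ltn_trans (s_gt j).
exists (range s); split => //.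
  rewrite (eq_finite_set (inj_card_eq _)); first exact: infinite_nat.
  by move=> i j _ _; exact: incn_inj.
(* Starting at [s 1 > 1] ensures [n >= 2], as the final estimate [n + 1 <= n ^ 2] requires. *)
apply/eqO_exP; exists 1 => //; exists (s 1%N) => // n /= sn.
have n_gt1 : (1 < n)%N := leq_trans (s_gt 1%N) sn.
(* This least [j] is the number of elements of [S] up to [n], namely [s 0], ..., [s (j - 1)]. *)
have [j nj j_min] : exists2 j, (n < s j)%N & forall i, (n < s i)%N -> (j <= i)%N.
  have ex : exists j, (n < s j)%N by exists n.
  by exists (ex_minn ex); case: ex_minnP.
have j_eps : (j.*2)%:R <= eps n.
  (* [j = 0] would mean [n < s 0], against [s 0 < s 1 <= n]. *)
  case: j nj j_min => [|j] nj j_min.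
    by have := leq_trans nj (leq_trans (ltnW (s_lt 0%N)) sn); rewrite ltnn.
  apply: epsN; apply: leq_trans (s_ge j) _; rewrite leqNgt; apply/negP => /j_min.
  by rewrite ltnn.
rewrite mul1r ger0_norm // ger0_norm ?powR_ge0 //.
apply: (@le_trans _ _ (n%:R `^ (j.*2)%:R)); last first.
  by apply: ler_powR => //; rewrite ler1n ltnW.
rewrite powR_mulrn // -natrX ler_nat -muln2 mulnC expnM.
apply: (@leq_trans (n.+1 ^ j)%N).
  rewrite -[X in (_ ^ X)%N]card_ord.
  apply: (@pS_upper_bound _ _ (fun i : 'I_j => s i)) => // _ [i _ <-] si.
  have ij : (i < j)%N.
    by rewrite ltnNge -s_mono -ltnNge (leq_ltn_trans si).
  by exists (Ordinal ij).
have [->//|j_gt0] := posnP j; rewrite leq_exp2r // -mulnn.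
(* The chain is [n + 1 <= 2 * n <= n * n]. *)
by rewrite (leq_trans _ (leq_mul n_gt1 (leqnn n))) // mul2n -addnn -addn1 leq_add2l ltnW.
Qed.

Theorem theorem2 (R : realType) :
  (forall S : set nat, S `<=` [set n | (0 < n)%N] -> infinite_set S ->
     forall k : R,
       ~ ((fun n : nat => (pS S n)%:R : R) =O_\oo
          (fun n : nat => (n%:R : R) `^ k))) /\
  (forall eps : nat -> R, eps @ \oo --> +oo ->
     exists S : set nat,
       [/\ S `<=` [set n | (0 < n)%N],
           infinite_set S &
           (fun n : nat => (pS S n)%:R : R) =O_\oo
           (fun n : nat => (n%:R : R) `^ (eps n))]).
Proof.
split=> [S S_gt0 S_inf k|eps]; first exact: pS_superpolynomial.
exact: slow_pS_exists.
Qed.
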